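(* Let $\sigma$ be a non-negative measure on the Borel subsets of $\mathbb{R}$ with all finite power moments, $\int_{\mathbb{R}}d\sigma=1$, and $\int_{\mathbb{R}}|g(x)|^2d\sigma>0$ for every non-zero complex polynomial $g$. Let $c>-1$ and $d\in\mathbb{R}$. Let $\{r_n(\lambda)\}_{n=0}^\infty$ be the orthonormal polynomials (with positive leading coefficients) with respect to $\sigma$, and let $a_n>0$, $b_n\in\mathbb{R}$ be their recurrence coefficients, i.e. the entries of the Jacobi matrix $J_3$ of $\sigma$. Let $\Theta=(J_3,J_5,\alpha,\beta)$ be the Jacobi-type pencil with $J_5=J_3^2$ and $$\alpha=\frac{1}{(c+1)\sqrt{\Delta_1}},\qquad \beta=-\frac{(c+1)s_1+d}{(c+1)\sqrt{\Delta_1}},$$ where $s_j=\int_{\mathbb{R}}x^jd\sigma$ and $\Delta_1=s_0s_2-s_1^2$; this is the pencil whose spectral function is $S(u,v)=\int_{\mathbb{R}}u(\mathcal{A})(1)\overline{v(\mathcal{A})(1)}d\sigma$, where $\mathcal{A}p(\lambda)=\lambda p(\lambda)+p(0)(c\lambda+d)$ on polynomials. Let $\{p_n(\lambda)\}_{n=0}^\infty$ be the associated polynomials of $\Theta$. Then: (1) For all $n\in\mathbb{Z}_+$, $$p_n(\lambda)=\frac{1}{c+1}r_n(\lambda)-\frac{d}{c+1}\,\frac{r_n(\lambda)-r_n(0)}{\lambda}+\frac{c}{c+1}r_n(0),$$ $$r_n(\lambda)=(c+1)p_n(\lambda)+(c+1)d\,\frac{p_n(\lambda)-p_n(d)}{\lambda-d}-c\,p_n(d),$$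 where the difference quotients are understood as limits at $\lambda=0$ and $\lambda=d$, respectively. (2) For all $n\in\mathbb{Z}_+$ and $\lambda\in\mathbb{C}$, $$\lambda p_n(\lambda)=\frac{p_n(d)}{c+1}(c\lambda+d)+a_{n-1}p_{n-1}(\lambda)+b_np_n(\lambda)+a_np_{n+1}(\lambda),$$ where $a_{-1}=0$, $p_{-1}=0$. (3) For all $n,m\in\mathbb{Z}_+$, $$\int_{\mathbb{R}\setminus\{d\}}(p_n(\lambda),p_n(d))\begin{pmatrix} (c+1)^2\left(\frac{\lambda}{\lambda-d}\right)^2 & (-c-1)\frac{\lambda(c\lambda+d)}{(\lambda-d)^2} \\ (-c-1)\frac{\lambda(c\lambda+d)}{(\lambda-d)^2} & \left(\frac{c\lambda+d}{\lambda-d}\right)^2 \end{pmatrix}\begin{pmatrix} p_m(\lambda) \\ p_m(d) \end{pmatrix}d\sigma$$ $$+(p_n(d),p_n'(d))\begin{pmatrix} 1 & (c+1)d \\ (c+1)d & (c+1)^2d^2 \end{pmatrix}\begin{pmatrix} p_m(d) \\ p_m'(d) \end{pmatrix}\sigma(\{d\})=\delta_{n,m}.$$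
   Context: $\mathbb{Z}_+$ denotes the non-negative integers. A Jacobi-type pencil is a tuple $\Theta=(J_3,J_5,\alpha,\beta)$, where $\alpha>0$, $\beta\in\mathbb{R}$, $J_3$ is a semi-infinite real symmetric tridiagonal (Jacobi) matrix, rows and columns indexed by $\mathbb{Z}_+$, with diagonal entries $b_k\in\mathbb{R}$ and $(J_3)_{k,k+1}=(J_3)_{k+1,k}=a_k>0$, and $J_5$ is a semi-infinite real symmetric five-diagonal matrix with positive entries $(J_5)_{k,k+2}=(J_5)_{k+2,k}$, $k\in\mathbb{Z}_+$. The associated polynomials of $\Theta$ are the unique system of polynomials $\{p_n(\lambda)\}_{n=0}^\infty$ with $p_0(\lambda)=1$, $p_1(\lambda)=\alpha\lambda+\beta$ and $(J_5-\lambda J_3)(p_0(\lambda),p_1(\lambda),p_2(\lambda),\ldots)^T=0$. The spectral function of $\Theta$ is the sesquilinear functional $S$ on the space $\mathbb{P}$ of complex polynomials with $S(p_n,p_m)=\delta_{n,m}$, $n,m\in\mathbb{Z}_+$. The Jacobi matrix $J_3$ of $\sigma$ is the one whose entries satisfy $\lambda r_n(\lambda)=a_{n-1}r_{n-1}(\lambda)+b_nr_n(\lambda)+a_nr_{n+1}(\lambda)$, $n\in\mathbb{Z}_+$, with $r_{-1}=0$, $a_{-1}=0$, $r_0=1$. For a polynomial $u(\lambda)=\sum_k d_k\lambda^k$, $u(\mathcal{A})=\sum_k d_k\mathcal{A}^k$, and $u(\mathcal{A})(1)$ is the result of applying this operator to the constant polynomial $1$. *)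

(* Defs.v *)
From HB Require Import structures.
From mathcomp Require Import all_boot all_order all_algebra.
From mathcomp Require Import all_classical all_reals all_analysis.
From mathcomp.real_closed Require Export complex.

Set Implicit Arguments.
Unset Strict Implicit.
Unset Printing Implicit Defensive.

Import Order.TTheory GRing.Theory Num.Theory.
Import numFieldNormedType.Exports.

Local Open Scope classical_set_scope.
Local Open Scope complex_scope.
Local Open Scope ring_scope.

Section ComplexIntegral.
Context {R : realType}.
Variable mu : probability (measurableTypeR R) R.

Definition cintegrable (D : set R) (f : R -> R[i]) : Prop :=
  mu.-integrable D (fun x => (complex.Re (f x))%:E) /\
  mu.-integrable D (fun x => (complex.Im (f x))%:E).

Definition cintegral (D : set R) (f : R -> R[i]) : R[i] :=
  (\int[mu]_(x in D) complex.Re (f x)) +i* (\int[mu]_(x in D) complex.Im (f x)).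

Definition moment (j : nat) : R := \int[mu]_(x in setT) x ^+ j.

Definition Delta1 : R := moment 0 * moment 2 - moment 1 ^+ 2.

End ComplexIntegral.

(* The summand with index n - 1 of a three-term recurrence, under the
   convention a_{-1} = 0, q_{-1} = 0. *)
Definition prev_term (R : realType) (a : nat -> R) (q : nat -> {poly R[i]})
    (n : nat) : {poly R[i]} :=
  if n is m.+1 then (a m)%:C *: q m else 0.

Section OrthonormalPolynomials.
Context {R : realType}.

(* The order of R[i] makes [0 < z] mean that z is real and positive. *)
Definition orthonormal_polynomials (mu : probability (measurableTypeR R) R)
    (r : nat -> {poly R[i]}) : Prop :=
  [/\ forall n, size (r n) = n.+1,
      forall n, 0 < lead_coef (r n) &
      forall n m, cintegral mu setT
        (fun x => (r n).[x%:C] * ((r m).[x%:C])^*) = (n == m)%:R].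

Definition recurrence_coefficients (r : nat -> {poly R[i]})
    (a b : nat -> R) : Prop :=
  [/\ forall n, 0 < a n,
      r 0%N = 1 &
      forall n, 'X * r n =
        prev_term a r n + (b n)%:C *: r n + (a n)%:C *: r n.+1].

End OrthonormalPolynomials.

Section Pencils.
Context {R : realType}.

Definition semi_infinite : Type := nat -> nat -> R.

Definition jacobi_matrix (a b : nat -> R) : semi_infinite :=
  fun i j => if i == j then b i
             else if j == i.+1 then a i
             else if i == j.+1 then a j
             else 0.

(* Sums over [set: nat] are finitely supported sums (fsbigop): they have their
   intended value as soon as the rows of the left factor are finite. *)
Definition semi_infinite_mul (A B : semi_infinite) : semi_infinite :=
  fun i j => \sum_(k \in [set: nat]) A i k * B k j.

Record pencil : Type := Pencil {
  pencil_J3 : semi_infinite;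
  pencil_J5 : semi_infinite;
  pencil_alpha : R;
  pencil_beta : R }.

Definition banded (w : nat) (A : semi_infinite) : Prop :=
  [/\ forall i j, A i j = A j i,
      forall i j, (i + w < j)%N -> A i j = 0 &
      forall i, 0 < A i (i + w)%N].

Definition jacobi_type_pencil (T : pencil) : Prop :=
  [/\ banded 1 (pencil_J3 T), banded 2 (pencil_J5 T) & 0 < pencil_alpha T].

Definition associated_polynomials (T : pencil) (p : nat -> {poly R[i]}) : Prop :=
  [/\ p 0%N = 1,
      p 1%N = (pencil_alpha T)%:C *: 'X + ((pencil_beta T)%:C)%:P &
      forall k, \sum_(j \in [set: nat])
        (((pencil_J5 T k j)%:C)%:P - (pencil_J3 T k j)%:C *: 'X) * p j = 0].

Definition sesquilinear (S : {poly R[i]} -> {poly R[i]} -> R[i]) : Prop :=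
  (forall (z : R[i]) u v w, S (z *: u + v) w = z * S u w + S v w) /\
  (forall (z : R[i]) u v w, S u (z *: v + w) = z^* * S u v + S u w).

Definition spectral_function (T : pencil)
    (S : {poly R[i]} -> {poly R[i]} -> R[i]) : Prop :=
  sesquilinear S /\
  exists2 p, associated_polynomials T p &
    forall n m, S (p n) (p m) = (n == m)%:R.

Definition opA (c d : R) (q : {poly R[i]}) : {poly R[i]} :=
  'X * q + q.[0] *: (c%:C *: 'X + (d%:C)%:P).

Definition poly_of_op (u : {poly R[i]}) (A : {poly R[i]} -> {poly R[i]})
    (q : {poly R[i]}) : {poly R[i]} :=
  \sum_(k < size u) u`_k *: iter k A q.

Definition pencil_functional (mu : probability (measurableTypeR R) R) (c d : R)
    (u v : {poly R[i]}) : R[i] :=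
  cintegral mu setT (fun x => (poly_of_op u (opA c d) 1).[x%:C] *
                              ((poly_of_op v (opA c d) 1).[x%:C])^*).

End Pencils.

(* The difference quotient (p(x) - p(x0)) / (x - x0), completed at x = x0 by
   its limit; x0^' is the filter of punctured neighbourhoods of x0. *)
Definition diff_quot (C : numFieldType) (p : {poly C}) (x0 x : C) : C :=
  if x == x0 then lim ((p.[z] - p.[x0]) / (z - x0) @[z --> x0^'])
  else (p.[x] - p.[x0]) / (x - x0).

Section Orthogonality.
Context {R : realType}.

Definition mx22 (x y z w : R) : 'M[R]_2 :=
  \matrix_(i, j) nth 0 (nth [::] [:: [:: x; y]; [:: z; w]] i) j.

Definition row2 (x y : R[i]) : 'rV[R[i]]_2 := \row_j nth 0 [:: x; y] j.

(* (x1, x2) M (y1, y2)^T, with no conjugation. *)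
Definition form2 (x1 x2 : R[i]) (M : 'M[R]_2) (y1 y2 : R[i]) : R[i] :=
  (row2 x1 x2 *m map_mx (real_complex R) M *m (row2 y1 y2)^T) 0 0.

Definition weight (c d x : R) : 'M[R]_2 :=
  mx22 ((c + 1) ^+ 2 * (x / (x - d)) ^+ 2)
       ((- c - 1) * (x * (c * x + d) / (x - d) ^+ 2))
       ((- c - 1) * (x * (c * x + d) / (x - d) ^+ 2))
       (((c * x + d) / (x - d)) ^+ 2).

Definition mass_matrix (c d : R) : 'M[R]_2 :=
  mx22 1                ((c + 1) * d)
       ((c + 1) * d)    ((c + 1) ^+ 2 * d ^+ 2).

End Orthogonality.

(* Main.v *)
(* Write [e = c + 1]. The substitution [u |-> u(A)(1)] has the closed form
   [W : u0 + (X - d) h |-> u0 + e X h], because [W 1 = 1] and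
   [W (X u) = A (W u)].
   Its inverse [V : u0 + X h |-> u0 + e^-1 (X - d) h] sends [r_n] to [p_n]:
   applying [V] to the recurrence of the [r_n] gives
   [X (V r_n) = (J3 (V r))_n + r_n(0) e^-1 (c X + d)], and the vector
   [(r_n(0))_n] is in the kernel of [J3], so that
   [J3^2 (V r) = X (J3 (V r))], while the associated polynomials are determined
   by this identity and by [p_0], [p_1]. The matrix weights in (3) just expand
   [W p_n * W p_m = r_n * r_m], off the point [d] and at [d]. *)
Require Import Defs.
From HB Require Import structures.
From mathcomp Require Import all_boot all_order all_algebra.
From mathcomp Require Import all_classical all_reals all_analysis.
From mathcomp.real_closed Require Import complex.
From mathcomp Require Import ring.
Import Order.TTheory GRing.Theory Num.Theory.
Import numFieldNormedType.Exports.
Local Open Scope classical_set_scope.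
Local Open Scope complex_scope.
Local Open Scope ring_scope.

(** * Polynomial difference quotients and the change of base point *)

Section Rebase.
Context {F : fieldType}.
Implicit Types (x y k : F) (q u v : {poly F}).

(** Exact division makes the quotient a polynomial, so its value at [x] exists without a limit and
    equals the derivative of [q] there. *)
Definition dquot x q := (q - q.[x]%:P) %/ ('X - x%:P).

Lemma dquotE x q : q = q.[x]%:P + ('X - x%:P) * dquot x q.
Proof.
have dv : 'X - x%:P %| q - q.[x]%:P.
  by rewrite dvdp_XsubCl rootE !hornerE subrr.
by rewrite /dquot mulrC (divpK dv) addrC subrK.
Qed.

Lemma dquot_unique x k q : dquot x (k%:P + ('X - x%:P) * q) = q.
Proof.
rewrite /dquot !hornerE subrr mul0r addr0 addrC addKr mulrC mulpK //.
by rewrite polyXsubC_eq0.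
Qed.

Lemma horner_dquot x q y : y != x ->
  (dquot x q).[y] = (q.[y] - q.[x]) / (y - x).
Proof.
move=> yx; rewrite {2}(dquotE x q) !hornerE addrAC subrr add0r mulrC mulKf //.
by rewrite subr_eq0.
Qed.

Lemma deriv_dquot x q : q^`().[x] = (dquot x q).[x].
Proof. by rewrite {1}(dquotE x q) !poly.derivE !hornerE subrr mul0r; ring. Qed.

(* Replaces [q.[x] + (X - x) h] by [q.[x] + k (X - y) h]. *)
Definition rebase x y k q := q.[x]%:P + k *: (('X - y%:P) * dquot x q).

Fact rebase_is_linear x y k : linear (rebase x y k).
Proof.
move=> z u v; have -> : rebase x y k (z *: u + v) =
    (z *: u + v).[x]%:P + k *: (('X - y%:P) * (z *: dquot x u + dquot x v)).
  rewrite /rebase; congr (_ + _ *: (_ * _)).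
  rewrite -divpZl -divpD /dquot hornerD hornerZ polyCD polyCM; congr (_ %/ _).
  by rewrite -!mul_polyC; ring.
by rewrite /rebase hornerD hornerZ polyCD polyCM -!mul_polyC; ring.
Qed.

HB.instance Definition _ x y k :=
  GRing.isLinear.Build F {poly F} {poly F} _ (rebase x y k)
    (rebase_is_linear x y k).

Lemma rebaseE x y k s q :
  rebase x y k (s%:P + ('X - x%:P) * q) = s%:P + k *: (('X - y%:P) * q).
Proof. rewrite /rebase dquot_unique hornerD hornerC hornerM hornerXsubC subrr.
by rewrite mul0r addr0. Qed.

Lemma rebaseC x y k s : rebase x y k s%:P = s%:P.
Proof. by have := rebaseE x y k s 0; rewrite !mulr0 scaler0 !addr0. Qed.

Lemma horner_rebase x y k q : (rebase x y k q).[y] = q.[x].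
Proof. rewrite /rebase hornerD hornerC hornerZ hornerM hornerXsubC subrr.
by rewrite mul0r mulr0 addr0. Qed.

Lemma dquot_rebase x y k q : dquot y (rebase x y k q) = k *: dquot x q.
Proof. by rewrite /rebase scalerAr dquot_unique. Qed.

Lemma rebaseK x y k : k != 0 -> cancel (rebase x y k) (rebase y x k^-1).
Proof.
move=> k0 q; rewrite {1}/rebase horner_rebase dquot_rebase -scalerAr.
by rewrite scalerA mulVf // scale1r -dquotE.
Qed.

(** With [x = d] this is the intertwining [W (X u) = A (W u)]: the value [q.[x]] is also the value
    of the rebased polynomial at 0. *)
Lemma rebase_mulX x c q :
  rebase x 0 (c + 1) ('X * q) =
  'X * rebase x 0 (c + 1) q + q.[x] *: (c *: 'X + x%:P).
Proof.
(* [X * q] has value [x * q.[x]] at [x] and difference quotient [q.[x] + X * dquot x q]. *)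
have -> : 'X * q = (x * q.[x])%:P + ('X - x%:P) * (q.[x]%:P + 'X * dquot x q).
  by rewrite {1}(dquotE x q) polyCM; ring.
by rewrite rebaseE /rebase subr0 -!mul_polyC polyCD polyCM; ring.
Qed.

(** The perturbing polynomial [c X + x] is an eigenvector: its value at 0 is [x], its quotient is
    [c], and [x - x c / (c + 1) = x / (c + 1)]. *)
Lemma rebase_affine x c : c + 1 != 0 ->
  rebase 0 x (c + 1)^-1 (c *: 'X + x%:P) = (c + 1)^-1 *: (c *: 'X + x%:P).
Proof.
move=> c1.
have -> : c *: 'X + x%:P = x%:P + ('X - 0%:P) * c%:P.
  by rewrite subr0 -mul_polyC; ring.
rewrite rebaseE subr0 -!mul_polyC.
(* Writing one [x] as [(c + 1)^-1 * ((c + 1) * x)] lets [ring] treat the inverse as an atom. *)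
rewrite -{1}(mulKf c1 x).
rewrite !polyCM polyCD; ring.
Qed.

End Rebase.

(** Off [x] both sides are the same fraction; at [x] the limit is the value of the polynomial
    [dquot x q], by its continuity. *)
Lemma diff_quotE (C : numFieldType) (q : {poly C}) (x y : C) :
  diff_quot q x y = (dquot x q).[y].
Proof.
rewrite /diff_quot; case: eqP => [->|/eqP yx]; last by rewrite horner_dquot.
apply: (cvg_lim (@norm_hausdorff _ _)).
have cont (u : {poly C}) : {for x, continuous (fun z : C => u.[z] : C)}.
  elim/poly_ind: u => [|u s IH].
    rewrite (_ : (fun z : C => _) = cst 0); first exact: cst_continuous.
    by apply/funext => z; rewrite horner0.
  have hE z : (u * 'X + s%:P).[z] = u.[z] * z + s by rewrite hornerMXaddC.
  rewrite (_ : (fun z : C => _) = (fun z : C => u.[z] * z + s)).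
    apply: continuousD; last exact: cst_continuous.
    by apply: continuousM => //; exact: id_continuous.
  exact/funext.
apply: cvg_trans (cvg_trans (cvg_app _ (@nbhs_dnbhs _ x)) (cont (dquot x q))).
apply: near_eq_cvg; near=> z; rewrite horner_dquot //.
by near: z; exact: nbhs_dnbhs_neq.
Unshelve. all: end_near. Qed.

Lemma fsbig_nat_ord (V : nmodType) (N : nat) (F : nat -> V) :
  (forall j, (N <= j)%N -> F j = 0) ->
  \sum_(j \in [set: nat]) F j = \sum_(j < N) F j.
Proof.
move=> F0; rewrite fsbig_ord; apply/esym/fsbig_widen => // j [_ /= /negP].
by rewrite -leqNgt; exact: F0.
Qed.

(** * Rows of a Jacobi matrix and of its square *)

Section JacobiMatrix.
Context {R : realType}.
Context (a b : nat -> R).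

(** [F j s] is the contribution of an entry [s] in column [j]; a general [F] covers both products of
    matrices and combinations of polynomials. *)
Lemma jacobi_row_sum (V : nmodType) (N i : nat) (F : nat -> R -> V) :
  (forall j, F j 0 = 0) -> (i.+1 < N)%N ->
  \sum_(j < N) F j (jacobi_matrix a b i j) =
  (if i is m.+1 then F m (a m) else 0) + F i (b i) + F i.+1 (a i).
Proof.
move=> F0 iN.
rewrite (eq_bigr (fun j : 'I_N => (if i == j.+1 then F j (a j) else 0) +
  (if j == i :> nat then F j (b j) else 0) +
  (if j == i.+1 :> nat then F j (a i) else 0))); last first.
  move=> j _; rewrite /jacobi_matrix (eq_sym i).
  case: (eqVneq (j : nat) i) => [->|ji].
    by rewrite ltn_eqF // add0r addr0.
  case: (eqVneq (j : nat) i.+1) => [->|ji1].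
    by rewrite (ltn_eqF (leqnSn i.+1)) !add0r.
  by case: eqP; rewrite ?F0 !addr0.
rewrite !big_split /= -!big_mkcond /=.
rewrite (big_ord1_eq _ (fun j => F j (b j))).
rewrite (big_ord1_eq _ (fun j => F j (a i))).
rewrite iN (ltnW iN); congr (_ + _ + _); case: i iN => [|i] iN.
  by rewrite big_pred0_eq.
under eq_bigl do rewrite eqSS eq_sym.
by rewrite (big_ord1_eq _ (fun j => F j (a j))) ltnW // ltnW.
Qed.

Lemma jacobi_sym i j : jacobi_matrix a b i j = jacobi_matrix a b j i.
Proof.
rewrite /jacobi_matrix (eq_sym j i); case: (eqVneq i j) => [->//|_].
case: (eqVneq j i.+1) => [->|_ //].
by rewrite (ltn_eqF (leqnSn i.+1)).
Qed.

Lemma jacobi_far i j : (i.+1 < j)%N -> jacobi_matrix a b i j = 0.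
Proof.
move=> ij; rewrite /jacobi_matrix (ltn_eqF (ltnW ij)) (gtn_eqF ij).
by rewrite ltn_eqF // ltnS ltnW // ltnW.
Qed.

Lemma jacobi_next i : jacobi_matrix a b i i.+1 = a i.
Proof. by rewrite /jacobi_matrix ltn_eqF // eqxx. Qed.

(** Row [i] ends at column [i.+1], so every cutoff [N] beyond it gives the same sum, and different
    rows can share one range. *)
Lemma jacobi_sqE N i j : (i.+1 < N)%N ->
  semi_infinite_mul (jacobi_matrix a b) (jacobi_matrix a b) i j =
  \sum_(k < N) jacobi_matrix a b i k * jacobi_matrix a b k j.
Proof.
move=> iN; apply: fsbig_nat_ord => k Nk.
by rewrite jacobi_far ?mul0r // (leq_trans iN).
Qed.

Context (a_gt0 : forall n, 0 < a n).

Lemma jacobi_banded : banded 1 (jacobi_matrix a b).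
Proof.
split=> [|i j|i]; first exact: jacobi_sym.
  by rewrite addn1; exact: jacobi_far.
by rewrite addn1 jacobi_next.
Qed.

Lemma jacobi_sq_banded :
  banded 2 (semi_infinite_mul (jacobi_matrix a b) (jacobi_matrix a b)).
Proof.
split=> [i j|i j|i].
- rewrite (@jacobi_sqE (maxn i j).+2 i) ?ltnS ?leq_maxl//.
  rewrite (@jacobi_sqE (maxn i j).+2 j) ?ltnS ?leq_maxr//.
  by apply: eq_bigr => k _; rewrite mulrC !(jacobi_sym k).
- rewrite addn2 => ij; rewrite (@jacobi_sqE i.+2)// big1// => k _.
  by rewrite (@jacobi_far k j) ?mulr0// (leq_ltn_trans (ltn_ord k) ij).
(* Of the three terms only the one through [i.+1] survives, which gives [a i * a i.+1]. *)
- rewrite addn2 (@jacobi_sqE i.+2)//.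
  rewrite (@jacobi_row_sum R _ _ (fun k x => x * jacobi_matrix a b k i.+2))//.
    rewrite jacobi_next (@jacobi_far i i.+2)// mulr0 addr0.
    rewrite ltr_wpDl ?mulr_gt0//; case: i => // i.
    by rewrite jacobi_far ?mulr0// ltnS ltnW.
  by move=> k; rewrite mul0r.
Qed.

Lemma jacobi_row_poly N i (q : nat -> {poly R[i]}) : (i.+1 < N)%N ->
  \sum_(j < N) (jacobi_matrix a b i j)%:C *: q j =
  prev_term a q i + (b i)%:C *: q i + (a i)%:C *: q i.+1.
Proof.
move=> iN; rewrite (@jacobi_row_sum _ _ _ (fun j x => x%:C *: q j)) //.
by move=> j; rewrite scale0r.
Qed.

End JacobiMatrix.

(** * Uniqueness of the associated polynomials *)

Section AssociatedPolynomials.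
Context {R : realType}.

Lemma pencil_row_sum (T : pencil) (p : nat -> {poly R[i]}) k N :
  jacobi_type_pencil T -> (k.+2 < N)%N ->
  \sum_(j \in [set: nat])
    (((pencil_J5 T k j)%:C)%:P - (pencil_J3 T k j)%:C *: 'X) * p j =
  \sum_(j < N) (pencil_J5 T k j)%:C *: p j
  - 'X * \sum_(j < N) (pencil_J3 T k j)%:C *: p j.
Proof.
move=> [[_ J3 _] [_ J5 _] _] kN; rewrite (@fsbig_nat_ord _ N) => [|j Nj].
  rewrite mulr_sumr -sumrB; apply: eq_bigr => j _.
  by rewrite -!mul_polyC; ring.
rewrite J3 ?J5 ?addn1 ?addn2 ?(leq_trans _ Nj) // 1?ltnW //.
by rewrite polyC0 scale0r subr0 mul0r.
Qed.

(** Row [n] determines the polynomial of index [n.+2] from the earlier ones: its coefficient there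
    comes from [J5] alone and is a positive constant. *)
Lemma associated_polynomials_unique (T : pencil) (p q : nat -> {poly R[i]}) :
  jacobi_type_pencil T -> associated_polynomials T p ->
  associated_polynomials T q -> p =1 q.
Proof.
move=> HT [p0 p1 pS] [q0 q1 qS] n.
elim/ltn_ind: n => -[|[|n]] IH; rewrite ?p0 ?q0 ?p1 ?q1 //.
have := etrans (pS n) (esym (qS n)); rewrite !(@pencil_row_sum _ _ _ n.+3) //.
have [[_ J3 _] [_ J5 J5gt] _] := HT.
rewrite !(big_ord_recr n.+2) /= J3 ?addn1 // !scale0r !addr0.
have pq (A : semi_infinite) : \sum_(j < n.+2) (A n j)%:C *: p j =
    \sum_(j < n.+2) (A n j)%:C *: q j.
  by apply: eq_bigr => j _; rewrite IH.
rewrite !pq =>  /addIr /addrI /(scalerI _); apply.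
by rewrite -(rmorph0 (real_complex R)) (inj_eq (@complexI R)) gt_eqF // -addn2.
Qed.

End AssociatedPolynomials.

(** * Linearity and integrability for complex-valued integrands *)

(*START*)
Section ComplexIntegration.
Context {R : realType} (mu : probability (measurableTypeR R) R).
Context (D : set (measurableTypeR R)) (mD : measurable D).
Implicit Types (z : R[i]) (f g : R -> R[i]).

Let Re_linear z u v : complex.Re (z * u + v) =
  complex.Re z * complex.Re u + (- complex.Im z * complex.Im u + complex.Re v).
Proof. by case: z u v => ? ? [? ?] [? ?] /=; ring. Qed.

Let Im_linear z u v : complex.Im (z * u + v) =
  complex.Re z * complex.Im u + (complex.Im z * complex.Re u + complex.Im v).
Proof. by case: z u v => ? ? [? ?] [? ?] /=; ring. Qed.

Let integrableM (s : R) (h : R -> R) : mu.-integrable D (EFin \o h) ->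
  mu.-integrable D (EFin \o (fun x => s * h x)).
Proof. exact: integrableZl. Qed.

Lemma cintegrable_linear z f g : cintegrable mu D f -> cintegrable mu D g ->
  cintegrable mu D (fun x => z * f x + g x).
Proof.
have lin (s t : R) (h1 h2 h3 : R -> R) : mu.-integrable D (EFin \o h1) ->
    mu.-integrable D (EFin \o h2) -> mu.-integrable D (EFin \o h3) ->
    mu.-integrable D (EFin \o (fun x => s * h1 x + (t * h2 x + h3 x))).
  move=> i1 i2 i3; have := integrableD mD (integrableM t _ i2) i3.
  exact: (integrableD mD (integrableM s _ i1)).
move=> [fr fi] [gr gi]; split.
  by under eq_fun do rewrite Re_linear; exact: lin.
by under eq_fun do rewrite Im_linear; exact: lin.
Qed.

Lemma cintegral_linear z f g : cintegrable mu D f -> cintegrable mu D g ->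
  cintegral mu D (fun x => z * f x + g x) =
  z * cintegral mu D f + cintegral mu D g.
Proof.
have lin (s t : R) (h1 h2 h3 : R -> R) : mu.-integrable D (EFin \o h1) ->
    mu.-integrable D (EFin \o h2) -> mu.-integrable D (EFin \o h3) ->
    \int[mu]_(x in D) (s * h1 x + (t * h2 x + h3 x)) =
    s * (\int[mu]_(x in D) h1 x) +
      (t * (\int[mu]_(x in D) h2 x) + \int[mu]_(x in D) h3 x).
  move=> i1 i2 i3.
  have i23 := integrableD mD (integrableM t _ i2) i3.
  rewrite (RintegralD mD (integrableM s _ i1) i23).
  by rewrite (RintegralD mD (integrableM t _ i2) i3) !RintegralZl.
move=> [fr fi] [gr gi]; apply/eqP; rewrite eq_complex Re_linear Im_linear /=.
rewrite -!lin //; apply/andP; split; apply/eqP; apply: eq_Rintegral => x _.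
  exact: Re_linear.
exact: Im_linear.
Qed.

Lemma cintegrable_horner (q : {poly R[i]}) :
  (forall k, mu.-integrable setT (fun x : R => (x ^+ k)%:E)) ->
  cintegrable mu D (fun x => q.[x%:C]).
Proof.
move=> imom.
have i0 : cintegrable mu D (fun=> 0) by split; exact: integrable0.
have iX k : cintegrable mu D (fun x => (x ^+ k)%:C).
  by split; [apply: integrableS (imom k) | exact: integrable0].
rewrite (_ : (fun x => _) =
    (fun x => \sum_(k < size q) q`_k * (x ^+ k)%:C)); last first.
  apply/funext => x; rewrite horner_coef; apply: eq_bigr => k _.
  by rewrite rmorphXn.
elim: (size q) => [|n IH]; first by under eq_fun do rewrite big_ord0.
under eq_fun do rewrite big_ord_recr /= addrC.
exact: cintegrable_linear.
Qed.

Lemma eq_cintegral f g : {in D, f =1 g} -> cintegral mu D f = cintegral mu D g.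
Proof.
move=> fg; rewrite /cintegral.
by congr Complex; apply: eq_Rintegral => x /fg ->.
Qed.

Lemma eq_cintegrable f g : {in D, f =1 g} ->
  cintegrable mu D f -> cintegrable mu D g.
Proof.
move=> fg [fr fi]; split.
  by apply: eq_integrable fr => // x /fg ->.
by apply: eq_integrable fi => // x /fg ->.
Qed.

End ComplexIntegration.

Lemma conj_real_complex (R : realType) (x : R) : (x%:C)^* = x%:C.
Proof. by rewrite conj_Creal //; apply/complex_realP; exists x. Qed.

(** * Integrals of polynomials and the contribution of a single point *)

Section PolynomialIntegral.
Context {R : realType} (mu : probability (measurableTypeR R) R).
Implicit Types (u v : {poly R[i]}) (z : R[i]).

(** Serves to detach the point [d], where the matrix weight has a zero denominator. *)
Lemma cintegral_split_point (x0 : R) (f : R -> R[i]) :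
  cintegrable mu setT f ->
  cintegral mu setT f =
  cintegral mu (~` [set x0]) f + f x0 * (fine (mu [set x0]))%:C.
Proof.
move=> [fr fi].
have split_at (h : R -> R) : mu.-integrable setT (EFin \o h) ->
    \int[mu]_x h x =
    \int[mu]_(x in ~` [set x0]) h x + h x0 * fine (mu [set x0]).
  move=> ih.
  have m1 : measurable [set x0 : measurableTypeR R] by exact: measurable_set1.
  rewrite -(setvU [set x0]) Rintegral_setU //; last 3 first.
  - exact: measurableC.
  - by rewrite setvU.
  - by apply/disj_setPS => x [].
  rewrite -(@Rintegral_cst _ _ _ mu _ m1); congr (_ + _).
  by apply: eq_Rintegral => x /[!inE] ->.
rewrite /cintegral (split_at _ fr) (split_at _ fi).
case: (f x0) => s t; apply/eqP.
by rewrite eq_complex /= !mulr0 subr0 add0r !eqxx.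
Qed.

Context (imom : forall k, mu.-integrable setT (fun x : R => (x ^+ k)%:E)).

Definition polyint u : R[i] := cintegral mu setT (fun x => u.[x%:C]).

Fact polyint_is_linear : linear_for *%R polyint.
Proof.
move=> z u v; rewrite /polyint; under eq_fun do rewrite hornerD hornerZ.
by apply: cintegral_linear => //; exact: cintegrable_horner.
Qed.

Lemma polyintXn k : polyint 'X^k = (moment mu k)%:C.
Proof.
rewrite /polyint; under eq_fun do rewrite hornerXn -rmorphXn.
by rewrite /cintegral /= Rintegral_cst ?mul0r.
Qed.

(** At real points, conjugating the coefficients conjugates the value, so the integrand of a
    sesquilinear form becomes one polynomial. *)
Definition conj_poly u : {poly R[i]} := map_poly Num.conj u.

Lemma horner_conj_poly u (x : R) : (conj_poly u).[x%:C] = u.[x%:C]^*.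
Proof.
by rewrite -{1}conj_real_complex horner_map.
Qed.

End PolynomialIntegral.

(** By linearity powers of [X] suffice; there [rebase_mulX] gives the induction step and the fixed
    constant 1 starts it. *)
Lemma poly_of_opE (R : realType) (c d : R) (u : {poly R[i]}) :
  poly_of_op u (opA c d) 1 = rebase d%:C 0 (c%:C + 1) u.
Proof.
have iterE k : iter k (opA c d) 1 = rebase d%:C 0 (c%:C + 1) 'X^k.
  elim: k => [|k IH]; first by rewrite expr0 -polyC1 rebaseC.
  by rewrite iterS IH exprS rebase_mulX /opA horner_rebase.
rewrite -[in RHS](coefK u) poly_def linear_sum /poly_of_op.
by apply: eq_bigr => k _; rewrite linearZ /= iterE.
Qed.

Lemma form2E (R : realType) (x1 x2 y1 y2 : R[i]) (s t u v : R) :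
  form2 x1 x2 (mx22 s t u v) y1 y2 =
  (x1 * s%:C + x2 * u%:C) * y1 + (x1 * t%:C + x2 * v%:C) * y2.
Proof.
rewrite /form2 !mxE !big_ord_recl !big_ord0 !mxE.
by rewrite !big_ord_recl !big_ord0 !mxE /= !addr0.
Qed.

(** * The transform [W], its inverse [V] and the matrix weights *)

Section Transform.
Context {R : realType} (c d : R) (c_gt : -1 < c).
Implicit Types (q : {poly R[i]}) (a b : nat -> R).

Local Notation e := (c%:C + 1).
Local Notation W := (rebase d%:C 0 e).
Local Notation V := (rebase 0 d%:C e^-1).

Lemma c1_neq0 : c + 1 != 0.
Proof. by rewrite gt_eqF // -ltrBlDr sub0r. Qed.

Lemma complex_c1 : (c + 1)%:C = e.
Proof. by rewrite rmorphD rmorph1. Qed.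

Lemma complex_c1_neq0 : e != 0.
Proof. by rewrite -complex_c1 fmorph_eq0 c1_neq0. Qed.

Lemma rebaseVK q : W (V q) = q.
Proof.
have := rebaseK 0 d%:C e^-1; rewrite invrK invr_eq0; apply.
exact: complex_c1_neq0.
Qed.

(** The weight has rank one: for [x != d], [W q] has at [x] the value
    [(e x q(x) - (c x + d) q(d)) / (x - d)], and the matrix is the outer square of this row of
    coefficients. *)
Lemma form2_weight q1 q2 (x : R) : x != d ->
  form2 q1.[x%:C] q1.[d%:C] (weight c d x) q2.[x%:C] q2.[d%:C] =
  (W q1).[x%:C] * (W q2).[x%:C].
Proof.
move=> xd; have xdC : x%:C - d%:C != 0 by rewrite -rmorphB fmorph_eq0 subr_eq0.
have xdC' : x%:C != d%:C by rewrite -subr_eq0.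
rewrite form2E /rebase !(hornerD, hornerZ, hornerM, hornerC, hornerX, hornerN).
rewrite !horner_dquot //.
rewrite !(rmorphM, rmorphD, rmorphB, rmorphN, rmorph1, rmorphXn, fmorphV).
by field.
Qed.

(** At [d] the difference quotient becomes the derivative: [W q] takes the value [q(d) + e d q'(d)],
    and the matrix is the outer square of [(1, e d)]. *)
Lemma form2_mass_matrix q1 q2 :
  form2 q1.[d%:C] (q1^`()).[d%:C] (mass_matrix c d) q2.[d%:C] (q2^`()).[d%:C] =
  (W q1).[d%:C] * (W q2).[d%:C].
Proof.
rewrite form2E !deriv_dquot /rebase.
rewrite !(hornerD, hornerZ, hornerM, hornerC, hornerX, hornerN).
rewrite !(rmorphM, rmorphD, rmorphB, rmorphN, rmorph1, rmorphXn).
ring.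
Qed.

Lemma prev_term_linear a (f : {linear {poly R[i]} -> {poly R[i]}}) r n :
  prev_term a (fun k => f (r k)) n = f (prev_term a r n).
Proof. by case: n => [|n] /=; rewrite ?linear0 ?linearZ. Qed.

(** * The transform applied to a three-term recurrence *)

Section Recurrence.
Context (a b : nat -> R) (r : nat -> {poly R[i]}).
Context (ab_recurrence : recurrence_coefficients r a b).

Let a_neq0 n : a n != 0.
Proof. by have [a_gt0 _ _] := ab_recurrence; rewrite gt_eqF. Qed.

(** Real recurrence coefficients make the polynomials real; this removes the conjugate from the
    orthonormality relations. *)
Lemma conj_poly_recurrence n : conj_poly (r n) = r n.
Proof.
have [_ r0 rS] := ab_recurrence.
elim/ltn_ind: n => -[|n] IH; first by rewrite r0 /conj_poly rmorph1.
have aC : (a n)%:C != 0 by rewrite fmorph_eq0.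
have -> : r n.+1 =
    (a n)%:C^-1 *: ('X * r n - (prev_term a r n + (b n)%:C *: r n)).
  by rewrite rS addrAC subrr add0r scalerA mulVf ?scale1r.
have prevJ : conj_poly (prev_term a r n) = prev_term a r n.
  case: n {aC} IH => [|n] IH /=; first by rewrite /conj_poly rmorph0.
  by rewrite /conj_poly map_polyZ /= conj_real_complex -/(conj_poly _) IH.
move: prevJ (IH n (ltnSn n)); rewrite /conj_poly => prevJ rJ.
rewrite map_polyZ /= fmorphV /= conj_real_complex rmorphB rmorphD rmorphM /=.
by rewrite map_polyX map_polyZ /= conj_real_complex prevJ rJ.
Qed.

Lemma recurrence_first : r 1%N = (a 0%N)%:C^-1 *: ('X - (b 0%N)%:C%:P).
Proof.
have [_ r0 rS] := ab_recurrence.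
have aC : (a 0%N)%:C != 0 by rewrite fmorph_eq0.
move: (rS 0%N); rewrite r0 mulr1 add0r alg_polyC => ->.
by rewrite addrAC subrr add0r scalerA mulVf ?scale1r.
Qed.

Lemma rebase_recurrence n :
  'X * V (r n) = ((r n).[0] / e) *: (c%:C *: 'X + d%:C%:P) +
    prev_term a (fun k => V (r k)) n + (b n)%:C *: V (r n) +
    (a n)%:C *: V (r n.+1).
Proof.
have [_ _ rS] := ab_recurrence.
(* The left side is written as [V (W _)]; under [W] the multiplication by [X] becomes [A], and
   [V r_n] takes the value [r_n(0)] at [d]. *)
rewrite -[LHS](rebaseK d%:C 0 e complex_c1_neq0) rebase_mulX rebaseVK.
rewrite horner_rebase (linearD V) (linearZ_LR V) /=.
rewrite rebase_affine ?complex_c1_neq0 //.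
rewrite scalerA rS !(linearD V) !(linearZ_LR V) (prev_term_linear a V) /=.
by rewrite addrC !addrA.
Qed.

(** [alpha] and [beta] are given through [a 0] and [b 0], so the argument is purely algebraic; the
    moments enter later. *)
Lemma associated_rebase (T : pencil) :
  jacobi_type_pencil T -> pencil_J3 T = jacobi_matrix a b ->
  pencil_J5 T =
    semi_infinite_mul (jacobi_matrix a b) (jacobi_matrix a b) ->
  pencil_alpha T = 1 / ((c + 1) * a 0%N) ->
  pencil_beta T = - (((c + 1) * b 0%N + d) / ((c + 1) * a 0%N)) ->
  associated_polynomials T (fun n => V (r n)).
Proof.
move=> HT J3 J5 al be; have [_ r0 rS] := ab_recurrence.
split=> [||k].
- by rewrite r0 -polyC1 rebaseC.
(* [r_1] is split at 0, with value [- b_0 / a_0] and quotient [1 / a_0], the form on which [V]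
   acts. *)
- have -> : r 1%N = (- (b 0%N / a 0%N))%:C%:P + ('X - 0%:P) * (a 0%N)^-1%:C%:P.
    rewrite recurrence_first -mul_polyC subr0 /= -(fmorphV (real_complex R)).
    by rewrite rmorphN rmorphM !polyCN !polyCM /=; ring.
  rewrite rebaseE -complex_c1 -(fmorphV (real_complex R)) al be -!mul_polyC.
  rewrite div1r invfM (_ : (_ + d) * _ = b 0%N / a 0%N +
    (c + 1)^-1 * (d / a 0%N)); last by field; rewrite c1_neq0 a_neq0.
  rewrite !(rmorphM, rmorphD, rmorphN) /=.
  by ring.
rewrite (@pencil_row_sum _ _ _ _ k.+3) // J3 J5.
pose g := c%:C *: 'X + d%:C%:P : {poly R[i]}.
(* [G i] is entry [i] of [J3 (V r)], as the rebased recurrence shows. *)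
pose G i := 'X * V (r i) - ((r i).[0] / e) *: g.
(* Row [k] of [J3] reaches index [k.+1], and the rows up to that one reach [k.+2]; hence the two
   ranges. *)
have -> : \sum_(j < k.+3)
    (semi_infinite_mul (jacobi_matrix a b) (jacobi_matrix a b) k j)%:C *: V (r j)
    = \sum_(i < k.+2) (jacobi_matrix a b k i)%:C *: G i.
  under eq_bigr do rewrite (@jacobi_sqE _ _ _ k.+2) // rmorph_sum scaler_suml.
  rewrite exchange_big; apply: eq_bigr => i _ /=.
  rewrite (_ : G i = \sum_(j < k.+3) (jacobi_matrix a b i j)%:C *: V (r j)).
    by rewrite scaler_sumr; apply: eq_bigr => j _; rewrite scalerA rmorphM.
  rewrite (@jacobi_row_poly _ a b k.+3 i (fun j => V (r j))) //; last first.
    exact: (ltn_ord i).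
  by rewrite /G rebase_recurrence /g; ring.
rewrite (@jacobi_row_poly _ a b k.+2 k G) //.
rewrite (@jacobi_row_poly _ a b k.+3 k (fun j => V (r j))) //.
have prevG : prev_term a G k = 'X * prev_term a (fun j => V (r j)) k -
    ((prev_term a r k).[0] / e) *: g.
  case: (k) => [|m] /=; first by rewrite horner0 mul0r scale0r mulr0 subr0.
  by rewrite /G hornerZ scalerBr scalerA mulrA scalerAr.
(* The recurrence at 0: the vector of the [r_n(0)] lies in the kernel of [J3], so the multiples of
   [g] cancel in [J3 G]. *)
have at0 : (prev_term a r k).[0] =
    - ((b k)%:C * (r k).[0] + (a k)%:C * (r k.+1).[0]).
  apply/eqP; rewrite -addr_eq0 addrA -!hornerZ -!hornerD -rS hornerM hornerX.
  by rewrite mul0r.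
rewrite prevG at0 /G -!mul_polyC !(polyCM, polyCN, polyCD).
by ring.
Qed.

End Recurrence.
End Transform.

(** * The first recurrence coefficients in terms of moments *)

Section FirstCoefficients.
Context {R : realType} (sigma : probability (measurableTypeR R) R).
Context (sigma_moments : forall k, sigma.-integrable setT (fun x : R => (x ^+ k)%:E)).
Context (r : nat -> {poly R[i]}).
Context (r_orthonormal : orthonormal_polynomials sigma r).
Context (a b : nat -> R) (ab_recurrence : recurrence_coefficients r a b).

Lemma polyint_orthonormal n m : polyint sigma (r n * r m) = (n == m)%:R.
Proof.
have [_ _ <-] := r_orthonormal; apply: eq_cintegral => x _.
by rewrite hornerM -horner_conj_poly (conj_poly_recurrence _ _ _ ab_recurrence).
Qed.

(** Expanding [X] and [X^2] in [1], [r 1] and [r 1 * r 1] and integrating gives [s_1 = b_0] and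
    [s_2 = a_0^2 + b_0^2]; the sign of [a_0] fixes the square root. *)
Lemma first_coefficients :
  b 0%N = moment sigma 1 /\ a 0%N = Num.sqrt (Delta1 sigma).
Proof.
have [a_gt0 r0 rS] := ab_recurrence.
have L := polyint_is_linear sigma sigma_moments.
have I1 : polyint sigma 1 = 1.
  by have := polyint_orthonormal 0 0; rewrite r0 mulr1.
have I0 : polyint sigma (r 1%N) = 0.
  by have := polyint_orthonormal 1 0; rewrite r0 mulr1.
(* Splitting the constant [b_0] as [b_0 - 1] times [1], plus [1], keeps the shape [z *: u + v] on
   which [L] rewrites. *)
have XE : 'X = (a 0%N)%:C *: r 1%N + (((b 0%N)%:C - 1) *: 1 + 1).
  have := rS 0%N; rewrite r0 mulr1 /= add0r addrC => ->.
  by rewrite scalerBl scale1r subrK.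
have m0 : moment sigma 0 = 1.
  by apply: (@complexI R); rewrite -polyintXn expr0 I1.
have m1 : moment sigma 1 = b 0%N.
  apply: (@complexI R); rewrite -polyintXn expr1 XE !L I0 I1.
  by rewrite mulr0 add0r mulr1 subrK.
have m2 : moment sigma 2 = a 0%N ^+ 2 + b 0%N ^+ 2.
  apply: (@complexI R); rewrite -polyintXn.
  have -> : 'X^2 = ((a 0%N)%:C * (a 0%N)%:C) *: (r 1%N * r 1%N) +
    (((a 0%N)%:C * (b 0%N)%:C + (a 0%N)%:C * (b 0%N)%:C) *: r 1%N +
     (((b 0%N)%:C * (b 0%N)%:C - 1) *: 1 + 1)).
    by rewrite expr2 XE -!mul_polyC !(polyCM, polyCN, polyCD, polyC1); ring.
  by rewrite !L polyint_orthonormal I0 I1 /= rmorphD !rmorphXn /=; ring.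
split=> //; rewrite /Delta1 m0 m1 m2 mul1r addrK sqrtr_sqr ger0_norm //.
exact: ltW.
Qed.

End FirstCoefficients.

(** * The spectral functional and the assembly of all claims *)

Lemma sesquilinear_pencil_functional (R : realType)
    (sigma : probability (measurableTypeR R) R) (c d : R) :
  (forall k, sigma.-integrable setT (fun x : R => (x ^+ k)%:E)) ->
  sesquilinear (pencil_functional sigma c d).
Proof.
move=> imom; have L := polyint_is_linear sigma imom.
pose W := rebase d%:C 0 (c%:C + 1).
have SE u v : pencil_functional sigma c d u v =
    polyint sigma (W u * conj_poly (W v)).
  apply: eq_cintegral => x _.
  by rewrite hornerM horner_conj_poly !poly_of_opE.
split=> z u v w; rewrite !SE.
  by rewrite /W linearP mulrDl -scalerAl L.
by rewrite /W linearP /conj_poly rmorphD /= map_polyZ /= mulrDr -scalerAr L.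
Qed.

Theorem theorem5 (R : realType) (sigma : probability (measurableTypeR R) R)
  (sigma_moments : forall k : nat,
     sigma.-integrable setT (fun x : R => (x ^+ k)%:E))
  (sigma_pos : forall g : {poly R[i]}, g != 0 ->
     0 < cintegral sigma setT (fun x : R => `|g.[x%:C]| ^+ 2))
  (c d : R) (c_gt : -1 < c)
  (r : nat -> {poly R[i]}) (r_orthonormal : orthonormal_polynomials sigma r)
  (a b : nat -> R) (ab_recurrence : recurrence_coefficients r a b)
  (Theta : pencil)
  (Theta_def : Theta = Pencil
     (jacobi_matrix a b)
     (semi_infinite_mul (jacobi_matrix a b) (jacobi_matrix a b))
     (1 / ((c + 1) * Num.sqrt (Delta1 sigma)))
     (- (((c + 1) * moment sigma 1 + d) /
         ((c + 1) * Num.sqrt (Delta1 sigma)))))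
  (p : nat -> {poly R[i]}) (p_associated : associated_polynomials Theta p) :
  [/\ jacobi_type_pencil Theta,
      spectral_function Theta (pencil_functional sigma c d),
      (forall (n : nat) (l : R[i]),
         (p n).[l] = 1 / (c + 1)%:C * (r n).[l]
                     - d%:C / (c + 1)%:C * diff_quot (r n) 0 l
                     + c%:C / (c + 1)%:C * (r n).[0] /\
         (r n).[l] = (c + 1)%:C * (p n).[l]
                     + (c + 1)%:C * d%:C * diff_quot (p n) d%:C l
                     - c%:C * (p n).[d%:C]),
      (forall (n : nat) (l : R[i]),
         l * (p n).[l] = (p n).[d%:C] / (c + 1)%:C * (c%:C * l + d%:C)
                         + (prev_term a p n).[l]
                         + (b n)%:C * (p n).[l]
                         + (a n)%:C * (p n.+1).[l]) &
      (forall n m : nat,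
         let f := fun x : R =>
           form2 (p n).[x%:C] (p n).[d%:C] (weight c d x)
                 (p m).[x%:C] (p m).[d%:C] in
         cintegrable sigma (~` [set d]) f /\
         cintegral sigma (~` [set d]) f
         + form2 (p n).[d%:C] ((p n)^`()).[d%:C] (mass_matrix c d)
                 (p m).[d%:C] ((p m)^`()).[d%:C]
           * (fine (sigma [set d]))%:C
         = (n == m)%:R)].
Proof.
have [a_gt0 r0 rS] := ab_recurrence.
have [b0 a0] :=
  first_coefficients sigma sigma_moments r r_orthonormal a b ab_recurrence.
have HT : jacobi_type_pencil Theta.
  rewrite Theta_def; split; [exact: jacobi_banded|exact: jacobi_sq_banded|].
  by rewrite /= -a0 divr_gt0 // mulr_gt0 // -ltrBlDr sub0r.
(* The closed form of [p_n] comes from uniqueness: the polynomials [V r_n] are also associated with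
   [Theta]. *)
have p_rebase n : p n = rebase 0 d%:C (c%:C + 1)^-1 (r n).
  apply: (associated_polynomials_unique Theta p
    (fun n => rebase _ _ _ (r n))) => //.
  by apply: (associated_rebase _ _ c_gt _ _ _ ab_recurrence) => //;
    rewrite Theta_def /= ?b0 ?a0.
have r_rebase n : r n = rebase d%:C 0 (c%:C + 1) (p n).
  by rewrite p_rebase rebaseVK.
have e0 := complex_c1_neq0 c c_gt.
have orth n m :=
  polyint_orthonormal sigma r r_orthonormal a b ab_recurrence n m.
split=> //.
- split; first exact: sesquilinear_pencil_functional.
  exists p => // n m; rewrite -orth; apply: eq_cintegral => x _.
  rewrite !poly_of_opE -!r_rebase hornerM -horner_conj_poly.
  by rewrite (conj_poly_recurrence _ _ _ ab_recurrence).
- move=> n l; rewrite !diff_quotE complex_c1; split.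
    (* With [h] the difference quotient at 0, [r_n(l) = r_n(0) + l h(l)] eliminates [r_n(l)]; what
       remains is a rational identity. *)
    have := congr1 (horner^~ l) (dquotE 0 (r n)).
    rewrite p_rebase /rebase.
    rewrite !(hornerD, hornerZ, hornerM, hornerN, hornerX, hornerC).
    by move=> ->; field.
  have := congr1 (horner^~ l) (dquotE d%:C (p n)).
  rewrite r_rebase /rebase.
  rewrite !(hornerD, hornerZ, hornerM, hornerN, hornerX, hornerC).
  by move=> ->; ring.
- move=> n l; rewrite complex_c1.
  have := rebase_recurrence c d c_gt a b r ab_recurrence n.
  move=> /(congr1 (horner^~ l)).
  have -> : prev_term a (fun k => rebase 0 d%:C (c%:C + 1)^-1 (r k)) n =
      prev_term a p n.
    by case: (n) => //= k; rewrite p_rebase.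
  rewrite -!p_rebase !(hornerD, hornerZ, hornerM, hornerX, hornerC) => ->.
  (* [p_n(d) = r_n(0)], since [W] moves the value at [d] to 0. *)
  by rewrite {1}r_rebase horner_rebase.
- move=> n m f.
  have fE : {in ~` [set d], (fun x : R => (r n * r m).[x%:C]) =1 f}.
    move=> x; rewrite inE /= => /eqP xd.
    by rewrite /f form2_weight // -!r_rebase hornerM.
  have mD : measurable (~` [set d : measurableTypeR R]).
    by apply: measurableC; exact: measurable_set1.
  split.
    apply: (eq_cintegrable _ _ mD _ _ fE); exact: cintegrable_horner.
  (* Off [d] and at [d] the two forms are values of the same polynomial [r_n * r_m], so the pieces
     add up to its integral over the whole line. *)
  rewrite -(eq_cintegral _ _ _ _ fE) form2_mass_matrix -!r_rebase -hornerM.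
  rewrite -cintegral_split_point; first exact: orth.
  exact: cintegrable_horner.
Qed.
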